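(* There exists a finite simple digraph $D$ with $\mathrm{SC}_\emptyset(D) < \mathrm{NCW}(D)$.
   Context: An abstract digraph decomposition of a digraph $D$ is a triple $(T,\beta,\gamma)$ with $T$ a rooted directed tree (edges directed away from the root), $\beta:V(T)\to 2^{V(D)}$, $\gamma:E(T)\to 2^{V(D)}$, $\bigcup_t\beta(t)=V(D)$. Let $\Gamma(t)=\beta(t)\cup\bigcup_{e\text{ incident with }t}\gamma(e)$, $T_t$ the subtree of nodes reachable from $t$, $\beta(T_t)=\bigcup_{t'\in V(T_t)}\beta(t')$; width $=\max_t|\Gamma(t)|-1$. An NCW-directed tree decomposition: $\{\beta(t)\}$ is a partition of $V(D)$ into nonempty sets, and for every $e=(s,t)\in E(T)$ there is no closed walk in $D-\gamma(e)$ containing a vertex of $\beta(T_t)$ and a vertex of $V(D)-\beta(T_t)$; $\mathrm{NCW}(D)$ is the minimum width of one. An $\mathrm{SC}_\emptyset$-directed tree decomposition: $\{\beta(t)\}$ is a partition of $V(D)$ into possibly empty sets with nonempty root bag; for every $e=(s,t)\in E(T)$, $\beta(T_t)$ is the vertex set of a strong component of $D-\gamma(e)$; and $|V(T)|\le|V(D)|^2$; $\mathrm{SC}_\emptyset(D)$ is the minimum width of one. *)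

(* Defs.v *)
From mathcomp Require Import all_boot.

Set Implicit Arguments.
Unset Strict Implicit.
Unset Printing Implicit Defensive.

(* Simple: no loops and no parallel arcs; a pair of opposite arcs is allowed. *)
Record digraph := Digraph {
  vertex : finType;
  arc : rel vertex;
  arc_irr : irreflexive arc
}.

Section Digraphs.

Variable D : digraph.
Implicit Types (X A C : {set vertex D}) (c : seq (vertex D)).

(* The arcs of D - X.  The relation lives on all of [vertex D], so the
   definitions below exclude the vertices of X explicitly. *)
Definition arc_del X : rel (vertex D) :=
  [rel x y | [&& x \notin X, y \notin X & arc x y]].

(* A closed walk is given by its cyclic sequence of vertices, repetitions
   allowed. *)
Definition closed_walk_del X c :=
  cycle (arc_del X) c && all [pred x | x \notin X] c.

Definition strong_component_del X C :=
  exists2 x, x \notin X &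
    C = [set y | [&& y \notin X, connect (arc_del X) x y
                  & connect (arc_del X) y x]].

End Digraphs.

(* The tree edges point away from the root: there is exactly one directed walk
   from the root to each node. *)
Definition rooted_tree (N : finType) (e : rel N) (r : N) :=
  forall t, exists! p : seq N, path e r p /\ last r p = t.

(* [guard s t] is the set gamma(s,t); it is only ever used when [tedge s t]. *)
Record decomposition (D : digraph) := Decomposition {
  node : finType;
  root : node;
  tedge : rel node;
  bag : node -> {set vertex D};
  guard : node -> node -> {set vertex D};
  tedge_tree : rooted_tree tedge root;
  bag_cover : \bigcup_t bag t = [set: vertex D]
}.

Section Width.

Variables (D : digraph) (T : decomposition D).
Implicit Types s t : node T.

Definition Gamma t : {set vertex D} :=
  bag t :|: \bigcup_(e : node T * node T
                     | tedge e.1 e.2 && ((e.1 == t) || (e.2 == t)))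
              guard e.1 e.2.

Definition subtree_bag t : {set vertex D} :=
  \bigcup_(t' | connect (@tedge D T) t t') bag t'.

(* The truncated subtraction is only visible when D has no vertex. *)
Definition width : nat := (\max_t #|Gamma t|) - 1.

Definition bags_disjoint :=
  forall s t, s != t -> [disjoint bag s & bag t].

Definition NCW_decomposition :=
  [/\ bags_disjoint,
      forall t, bag t != set0
    & forall s t, tedge s t ->
        ~ exists c, [/\ closed_walk_del (guard s t) c,
                        has [in subtree_bag t] c
                      & has [in ~: subtree_bag t] c]].

Definition SCempty_decomposition :=
  [/\ bags_disjoint,
      bag (root T) != set0,
      forall s t, tedge s t ->
        strong_component_del (guard s t) (subtree_bag t)
    & #|node T| <= #|vertex D| ^ 2].

End Width.

Definition is_min_width (D : digraph) (P : decomposition D -> Prop) (k : nat) :=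
  (exists2 T, P T & width T = k) /\ (forall T, P T -> k <= width T).

(* These are relations because the minimum does not exist when D has no
   vertex. *)
Definition NCW_is (D : digraph) (k : nat) :=
  is_min_width (@NCW_decomposition D) k.
Definition SCempty_is (D : digraph) (k : nat) :=
  is_min_width (@SCempty_decomposition D) k.

(* Main.v *)
(* The witness has eleven vertices.  The vertices 0, ..., 4 carry the three
   bidirected triangles {0, 1, i} for i = 2, 3, 4, and for each pair x < b in
   {2, 3, 4} a two-vertex gadget {v, p} is entered only from 0 and x and left
   only towards x and b.  In a decomposition of width 2 each of the six triples
   {0, i, j} with 1 <= i < j <= 4 must be Gamma(t) for some t.  When all bags are
   nonempty, these six nodes own disjoint nonempty subsets of {0, ..., 4}, which
   is impossible; so NCW > 2.  With empty bags allowed, a node with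
   Gamma = {0, x, b} merely replaces the guard {0, x} on the gadget's entrances
   by the guard {x, b} on its exits, after which v can be bagged and x
   released; so SC_empty <= 2. *)
From mathcomp Require Import all_boot.
Require Import Defs.
From Stdlib Require Import Classical.

Set Implicit Arguments.
Unset Strict Implicit.
Unset Printing Implicit Defensive.

(** * Existence of minimum widths *)

Section Minimum.

Variables (D : digraph) (P : decomposition D -> Prop).

(** Descent on the width. Excluded middle is used because [P] and the quantification over all
    decompositions are not decidable. *)
Lemma is_min_width_exists (T : decomposition D) :
  P T -> exists2 k, k <= width T & is_min_width P k.
Proof.
have [n] := ubnP (width T); elim: n T => // n IHn T; rewrite ltnS => leTn PT.
have [minT | /not_all_ex_not[S notle]] := classic (forall S, P S -> width T <= width S).
  by exists (width T) => //; split=> //; exists T.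
have [PS /negP] := imply_to_and _ _ notle; rewrite -ltnNge => ltST.
have [k lekS mink] := IHn S (leq_trans ltST leTn) PS.
by exists k => //; apply: leq_trans lekS (ltnW ltST).
Qed.

End Minimum.

(** * Walks and strong components after deleting a vertex set *)

Section Walks.

Variable D : digraph.
Implicit Types (X Y : {set vertex D}) (x y z : vertex D).

Lemma connect_del1 X x y :
  x \notin X -> y \notin X -> arc x y -> connect (arc_del X) x y.
Proof. by move=> xX yX xy; apply: connect1; apply/and3P. Qed.

Lemma connect_delS X Y x y :
  X \subset Y -> connect (arc_del Y) x y -> connect (arc_del X) x y.
Proof.
move=> /subsetP sXY; apply: connect_sub => {}x {}y /= /and3P[xY yY xy].
by apply: connect_del1 => //; [apply: contra xY | apply: contra yY]; apply: sXY.
Qed.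

Lemma path_del_notin X x p : path (arc_del X) x p -> all [pred y | y \notin X] p.
Proof. by elim: p x => //= y p IHp x /andP[/and3P[_ -> _] /IHp]. Qed.

(** Walks may be empty, so [biconnected X x x] holds even for [x] in [X]; for distinct vertices both
    must lie outside [X]. *)
Definition biconnected X x y :=
  connect (arc_del X) x y && connect (arc_del X) y x.

Lemma biconnectedS X Y x y :
  X \subset Y -> biconnected Y x y -> biconnected X x y.
Proof. by move=> sXY /andP[xy yx]; rewrite /biconnected !(connect_delS sXY). Qed.

Lemma biconnected_edge X x y :
  arc x y -> arc y x -> x \notin X -> y \notin X -> biconnected X x y.
Proof. by move=> *; rewrite /biconnected !connect_del1. Qed.

Lemma cycle_biconnected X c x y :
    cycle (@arc D) c -> all [pred z | z \notin X] c ->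
  x \in c -> y \in c -> biconnected X x y.
Proof.
move=> arc_c c_notin xc yc.
have cyc_c : cycle (arc_del X) c.
  apply: sub_in_cycle c_notin arc_c => u v; rewrite !inE => uX vX uv.
  exact/and3P.
by rewrite /biconnected !(connect_cycle cyc_c).
Qed.

Lemma biconnected_closed_walk X x y :
  x != y -> biconnected X x y ->
  exists c, [/\ closed_walk_del X c, x \in c & y \in c].
Proof.
move=> neq_xy /andP[/connectP[[|z p] xp def_y] /connectP[q yq def_x]].
  by rewrite def_y eqxx in neq_xy.
(* The concatenated walk starts and ends at [x]; its cyclic sequence keeps only the final
   occurrence. *)
rewrite /= in def_y; exists (z :: p ++ q).
split; last by rewrite -cat_cons mem_cat def_y mem_last.
- have path_c : path (arc_del X) x (z :: p ++ q) by rewrite -cat_cons cat_path xp /= -def_y.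
  rewrite /closed_walk_del (cycle_path x) (path_del_notin path_c) andbT.
  by rewrite /= last_cat -def_y -def_x.
have -> : x = last z (p ++ q) by rewrite last_cat -def_y.
exact: mem_last.
Qed.

(** The closed walk makes [C] strongly connected. For maximality, closure under out-arcs or under
    in-arcs suffices, since a vertex of the component of [x] is both reachable from [x] and able to
    reach it. *)
Lemma strong_component_path X (C : {set vertex D}) x p :
    x \notin X -> path (arc_del X) x p -> last x p = x ->
    (forall y, (y \in C) = (y \in x :: p)) ->
    (forall y z, arc_del X y z -> y \in C -> z \in C) \/
    (forall y z, arc_del X y z -> z \in C -> y \in C) ->
  strong_component_del X C.
Proof.
move=> xX xp lastx inC clC; exists x => //; apply/setP=> y; rewrite inE.
have xC : x \in C by rewrite inC mem_head.
apply/idP/and3P => [|[_ xy yx]].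
  rewrite inC => /[dup] y_in; rewrite inE => /predU1P[-> | yp].
    by rewrite xX connect0.
  split; first by have /allP/(_ y yp) := path_del_notin xp.
    exact: (path_connect xp y_in).
  case/splitPr: yp xp lastx => p1 p2; rewrite cat_path last_cat /=.
  by case/and3P=> _ _ yp2 lastx; apply/connectP; exists p2.
case: clC => [outC | inC'].
  case/connectP: xy => q; elim: q x xC {xX xp lastx inC yx} => [x xC _ -> // | z q IHq] x xC.
  by case/andP=> xz zq def_y; apply: (IHq z) => //; apply: outC xz xC.
case/connectP: yx => q; elim: q y {xy} => [y /= _ <- // | z q IHq] y /= /andP[yz zq] def_x.
exact: inC' yz (IHq _ zq def_x).
Qed.

End Walks.

(** * Rooted trees: induction, parent functions, subtree bags *)

Section RootedTree.

Variables (N : finType) (e : rel N) (r : N).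
Hypothesis tree : rooted_tree e r.

Lemma rooted_tree_connect t : connect e r t.
Proof. by have [p [[rp <-] _]] := tree t; apply/connectP; exists p. Qed.

(** A walk from [t] back to [s] would extend the root walk to [s] into a second, longer one. *)
Lemma rooted_tree_acyclic s t : e s t -> ~~ connect e t s.
Proof.
move=> st; apply/connectP=> -[q tq def_s].
have [p [[rp def_p] uniqp]] := tree s.
have /uniqp/(congr1 size)/eqP : path e r (p ++ t :: q) /\ last r (p ++ t :: q) = s.
  by rewrite cat_path last_cat rp def_p /= st tq.
by rewrite size_cat -[X in X == _]addn0 eqn_add2l.
Qed.

(** Induction from the leaves up. The measure is the size of the subtree, which loses [s] on passing
    to a child, by acyclicity. *)
Lemma rooted_tree_ind (P : N -> Prop) :
  (forall s, (forall t, e s t -> P t) -> P s) -> forall s, P s.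
Proof.
move=> IH s; have [n] := ubnP #|[set t | connect e s t]|.
elim: n s => // n IHn s; rewrite ltnS => le_n; apply: IH => t st; apply: IHn.
apply: leq_trans le_n; apply: proper_card; apply/properP; split.
  by apply/subsetP=> u; rewrite !inE; apply/connect_trans/connect1.
by exists s; rewrite inE ?connect0 ?rooted_tree_acyclic.
Qed.

End RootedTree.

Section ParentTree.

Variables (n : nat) (parent : nat -> nat).
Hypothesis lt_parent : forall k, 0 < k <= n -> parent k < k.

(** The test [0 < t] makes node 0 the root, whatever the value of [parent 0]. *)
Definition parent_edge : rel 'I_n.+1 :=
  [rel s t : 'I_n.+1 | (0 < t) && (s == parent t :> nat)].

Lemma parent_rooted_tree : rooted_tree parent_edge ord0.
Proof.
move=> t; have [m] := ubnP (val t); elim: m t => // m IHm t; rewrite ltnS => le_tm.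
have [t0 | t_gt0] := posnP t.
  exists [::]; split=> [|p]; first by split=> //; apply: val_inj.
  case/lastP: p => // p u [+ def_u]; rewrite last_rcons in def_u.
  by rewrite def_u rcons_path {2}/parent_edge /= t0 andbF.
have lt_pt : parent t < t by rewrite lt_parent // t_gt0 -ltnS /=.
pose s : 'I_n.+1 := Ordinal (ltn_trans lt_pt (ltn_ord t)).
have [p [[rp def_s] uniq_p]] := IHm s (leq_trans lt_pt le_tm).
exists (rcons p t); split=> [|q].
  by rewrite rcons_path last_rcons rp def_s /parent_edge /= t_gt0 eqxx.
case/lastP: q => [[_ def_t] | q u [+ def_u]]; first by rewrite -def_t in t_gt0.
rewrite last_rcons in def_u; rewrite {u}def_u rcons_path => /and3P[rq _ /eqP def_q].
by rewrite (uniq_p q) //; split=> //; apply: val_inj.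
Qed.

End ParentTree.

(** The recursion over children has a unique solution, so a proposed table of subtree bags can be
    checked locally. *)
Lemma subtree_bagE (D : digraph) (T : decomposition D) (B : node T -> {set vertex D}) :
    (forall t, B t = bag t :|: \bigcup_(s | tedge t s) B s) ->
  forall t, subtree_bag t = B t.
Proof.
move=> defB; elim/(rooted_tree_ind (@tedge_tree D T)) => t IHt.
rewrite defB; apply/setP=> x; rewrite inE; apply/bigcupP/orP.
  case=> u /connectP[[|s p] /= tp def_u] xu; first by left; rewrite -def_u.
  case/andP: tp => ts sp; right; apply/bigcupP; exists s => //.
  by rewrite -IHt //; apply/bigcupP; exists u => //; apply/connectP; exists p.
case=> [xt | /bigcupP[s ts]]; first by exists t; rewrite ?connect0.
rewrite -IHt // => /bigcupP[u su xu]; exists u => //.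
exact: connect_trans (connect1 ts) su.
Qed.

(** * Havens and the sets forced in NCW decompositions of width 2 *)

Section NCW.

Variables (D : digraph) (T : decomposition D).
Implicit Types s t : node T.
Hypothesis ncwT : NCW_decomposition T.

Lemma bag_sub_Gamma t : bag t \subset Gamma t.
Proof. exact: subsetUl. Qed.

Lemma guard_sub_Gamma s t :
  tedge s t -> guard s t \subset Gamma s :&: Gamma t.
Proof.
move=> st; rewrite subsetI; apply/andP; split; apply: subsetU; apply/orP; right;
  by apply: (bigcup_max (s, t)) => //=; rewrite st eqxx ?orbT.
Qed.

Lemma subtree_bag_biconnected s t x y :
    tedge s t -> biconnected (guard s t) x y ->
  x \in subtree_bag t -> y \in subtree_bag t.
Proof.
move=> st xy xt; apply/negPn/negP=> yt; have [_ _ /(_ s t st)] := ncwT; apply.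
have neq_xy : x != y by apply: contraNneq yt => <-.
have [c [walk_c xc yc]] := biconnected_closed_walk neq_xy xy.
exists c; split=> //; apply/hasP; first by exists x.
by exists y; rewrite // inE.
Qed.

(* [h t] is the robber's answer to cops on [Gamma t]: following the child whose
   subtree contains [h t], one never reaches a leaf. *)
Lemma no_haven (h : node T -> vertex D) :
    (forall t, h t \notin Gamma t) ->
    (forall s t, biconnected (Gamma s :&: Gamma t) (h s) (h t)) ->
  False.
Proof.
move=> h_notin h_conn.
suff no_h t : h t \notin subtree_bag t.
  have: h (root T) \in \bigcup_t @bag D T t by rewrite bag_cover inE.
  case/bigcupP=> t _ ht.
  have /bigcupP[] := no_h (root T).
  by exists t => //; apply: (rooted_tree_connect (@tedge_tree D T)).
elim/(rooted_tree_ind (@tedge_tree D T)): t => t IHt.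
apply/negP=> /bigcupP[t' /connectP[[|s p] /=]].
  by move=> _ ->; apply/negP; apply: contra (h_notin t); apply: subsetP (bag_sub_Gamma t) _.
case/andP=> ts sp def_t' ht; have /negP[] := IHt s ts.
apply: (subtree_bag_biconnected ts (biconnectedS (guard_sub_Gamma ts) (h_conn t s))).
by apply/bigcupP; exists t' => //; apply/connectP; exists p.
Qed.

(** Otherwise the first of [a], [b], [c] outside [Gamma t] defines a haven: any two of them are
    joined by opposite arcs. *)
Lemma Gamma_of_triangle a b c :
    arc a b -> arc b a -> arc b c -> arc c b -> arc a c -> arc c a ->
  exists t, [set a; b; c] \subset Gamma t.
Proof.
move=> ab ba bc cb ac ca; apply/existsP; apply: contraT => /existsPn no_t.
pose h t := if a \notin Gamma t then a else if b \notin Gamma t then b else c.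
have h_notin t : h t \notin Gamma t.
  have := no_t t; rewrite !subUset !sub1set /h.
  by case: ifPn => // /negbNE->; case: ifPn => // /negbNE->.
have h_abc t : h t \in [:: a; b; c].
  by rewrite /h; do 2?case: ifP => _; rewrite !inE eqxx ?orbT.
case: (@no_haven h) => // s t.
set X := Gamma s :&: Gamma t.
have sX : h s \notin X by rewrite in_setI (negPf (h_notin s)).
have tX : h t \notin X by rewrite in_setI (negPf (h_notin t)) andbF.
clearbody X; move: (h_abc s) (h_abc t) sX tX; rewrite !inE.
by case/or3P=> /eqP->; case/or3P=> /eqP->;
   first [exact: biconnected_edge | rewrite /biconnected !connect0].
Qed.

Hypothesis width2 : forall t, #|Gamma t| <= 3.

Lemma Gamma_full t (s : seq (vertex D)) z :
  uniq (rcons s z) -> size s = 3 -> all [in Gamma t] s -> z \notin Gamma t.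
Proof.
move=> uniq_sz size_s /allP/= sub_s; apply: contraL (width2 t) => zt.
rewrite -ltnNge -size_s -(size_rcons s z) -(card_uniqP uniq_sz).
apply/subset_leq_card/subsetP=> y; rewrite mem_rcons inE.
by case/predU1P=> [-> // | /sub_s].
Qed.

(* The haven that no other set can block answers with the first of a, x, v, p
   outside [Gamma t].  [u] serves only as a detour from b to x avoiding a. *)
Lemma Gamma_of_gadget a x v p b u :
    uniq [:: a; x; v; p; b; u] ->
    arc a x -> arc x a -> arc x v -> arc v x -> arc v p -> arc p v ->
    arc x p -> arc a v -> arc a p -> arc v b -> arc p b ->
    arc b a -> arc b u -> arc u x ->
  exists t, [set a; x; b] \subset Gamma t.
Proof.
move=> U ax xa xv vx vp pv xp av ap vb pb ba bu ux.
apply/existsP; apply: contraT => /existsPn no_t.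
pose h t := if a \notin Gamma t then a else if x \notin Gamma t then x
            else if v \notin Gamma t then v else p.
(* When [a], [x], [v] fill [Gamma t], each of [p], [b], [u] is outside. The mask [m] selects a
   sublist, which inherits distinctness. *)
have full t z m : [:: a; x; v; z] = mask m [:: a; x; v; p; b; u] ->
    a \in Gamma t -> x \in Gamma t -> v \in Gamma t -> z \notin Gamma t.
  move=> def_m at_ xt vt; apply: (@Gamma_full t [:: a; x; v]) => //.
    by rewrite [rcons _ _]def_m mask_uniq.
  by rewrite /= at_ xt vt.
pose full_p t := full t p [:: true; true; true; true] erefl.
pose full_b t := full t b [:: true; true; true; false; true] erefl.
pose full_u t := full t u [:: true; true; true; false; false; true] erefl.
have no_b t : a \in Gamma t -> x \in Gamma t -> b \notin Gamma t.
  by move=> at_ xt; have := no_t t; rewrite !subUset !sub1set at_ xt.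
have h_cases t : [\/ h t = a /\ a \notin Gamma t,
    h t = x /\ x \notin Gamma t,
    [/\ h t = v, v \notin Gamma t & b \notin Gamma t]
  | [/\ h t = p, p \notin Gamma t, b \notin Gamma t & u \notin Gamma t]].
  rewrite /h; case: ifPn => [|/negbNE at_]; first by constructor 1.
  case: ifPn => [|/negbNE xt]; first by constructor 2.
  case: ifPn => [vt|/negbNE vt]; first by constructor 3; split=> //; apply: no_b.
  by constructor 4; split=> //; [apply: full_p | apply: full_b | apply: full_u].
case: (@no_haven h) => [t | s t].
  by case: (h_cases t) => [[-> //]|[-> //]|[-> //]|[-> //]].
set X := Gamma s :&: Gamma t.
have notX z : (z \notin Gamma s) || (z \notin Gamma t) -> z \notin X.
  by rewrite in_setI negb_and.
clearbody X.
case: (h_cases s) => [[-> sa]|[-> sx]|[-> sv sb]|[-> sp sb su]];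
case: (h_cases t) => [[-> ta]|[-> tx]|[-> tv tb]|[-> tp tb tu]];
  try by rewrite /biconnected !connect0.
(* Two distinct answers lie on a common cycle avoiding [X]: [v] and [p] get to [a] through [b], and
   [p] gets to [x] through [b] and [u], all free in the cases concerned. The other pairs have
   opposite arcs. *)
all: let walk c :=
       (apply: (@cycle_biconnected _ _ c);
        rewrite /= ?inE ?eqxx ?orbT // ?notX ?sa ?sx ?sv ?sp ?sb ?su
                ?ta ?tx ?tv ?tp ?tb ?tu ?orbT //
                ?(ax, xa, xv, vx, vp, pv, xp, av, ap, vb, pb, ba, bu, ux); done) in
     first [walk [:: a; x] | walk [:: x; v] | walk [:: v; p]
           | walk [:: v; b; a] | walk [:: p; b; u; x] | walk [:: a; p; b]].
Qed.

(** Distinct sets [F i] come from distinct nodes, whose bags are disjoint and nonempty; choosing a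
    vertex in each bag injects [I] into the union. *)
Lemma card_Gamma_family (I : finType) (F : I -> {set vertex D}) :
    injective F -> (forall i, exists t, Gamma t = F i) ->
  #|I| <= #|\bigcup_i F i|.
Proof.
move=> injF /fin_all_exists[t_ GammaF]; have [disjT nonempty _] := ncwT.
have /fin_all_exists[y_ y_bag] i : exists y, y \in bag (t_ i).
  exact/set0Pn/nonempty.
have inj_y : injective y_.
  move=> i j eq_y; apply: injF; rewrite -!GammaF; congr (Gamma _).
  apply/eqP/negPn/negP=> /disjT/disjointFr/(_ (y_bag i)).
  by rewrite eq_y y_bag.
rewrite -(card_imset _ inj_y); apply/subset_leq_card/subsetP=> _ /imsetP[i _ ->].
apply/bigcupP; exists i => //; rewrite -GammaF.
exact: subsetP (bag_sub_Gamma _) _ (y_bag i).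
Qed.

End NCW.

(** * The eleven-vertex digraph and its lower bound *)

Definition both (i j : nat) := [:: (i, j); (j, i)].

(** Only the arcs at [v] and [p]. The arcs among [a], [x], [b] and the detour vertex, which is 1,
    come from the triangles. *)
Definition gadget_arcs (a x v p b : nat) :=
  both x v ++ both v p ++ [:: (x, p); (a, v); (a, p); (v, b); (p, b)].

Definition arcs : seq (nat * nat) :=
  both 0 1 ++ flatten [seq both 0 i ++ both 1 i | i <- [:: 2; 3; 4]]
    ++ gadget_arcs 0 2 5 6 3 ++ gadget_arcs 0 2 7 8 4 ++ gadget_arcs 0 3 9 10 4.

Definition example_arc : rel 'I_11 := [rel x y : 'I_11 | (val x, val y) \in arcs].

Lemma example_arc_irr : irreflexive example_arc.
Proof.
move=> x; apply/negP=> /= /(allP (isT : all [pred e | e.1 != e.2] arcs)).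
by rewrite /= eqxx.
Qed.

Definition example := Digraph example_arc_irr.

(** Number lists turn questions about vertex sets into computations. *)
Definition vset (l : seq nat) : {set 'I_11} := [set x | val x \in l].

Lemma card_vset l : #|vset l| = count [in l] (iota 0 11).
Proof.
rewrite -val_enum_ord count_map enumT cardE /enum_mem size_filter.
by apply: eq_count => x /=; rewrite inE.
Qed.

Lemma vset_inj l l' : vset l = vset l' ->
  [seq k <- iota 0 11 | k \in l] = [seq k <- iota 0 11 | k \in l'].
Proof.
move=> eq_l; apply: eq_in_filter => k; rewrite mem_iota /= => lt_k.
by have /setP/(_ (Ordinal lt_k)) := eq_l; rewrite !inE.
Qed.

Notation v_ i := (@Ordinal 11 i isT).

Definition triples := [:: [:: 0; 1; 2]; [:: 0; 1; 3]; [:: 0; 1; 4];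
                          [:: 0; 2; 3]; [:: 0; 2; 4]; [:: 0; 3; 4]].

Lemma vset3 (x y z : 'I_11) : [set x; y; z] = vset [:: val x; val y; val z].
Proof. by apply/setP=> w; rewrite !inE -!val_eqE orbA. Qed.

Lemma triple_forced (T : decomposition example) (i : 'I_6) :
    NCW_decomposition T -> (forall t : node T, #|Gamma t| <= 3) ->
  exists t : node T, vset (nth [::] triples i) \subset Gamma t.
Proof.
move=> ncwT width2.
have triangle := @Gamma_of_triangle example T ncwT.
have gadget := @Gamma_of_gadget example T ncwT width2.
case: i => -[|[|[|[|[|[|//]]]]]] lt_i /=.
- by have := triangle (v_ 0) (v_ 1) (v_ 2); rewrite vset3; apply.
- by have := triangle (v_ 0) (v_ 1) (v_ 3); rewrite vset3; apply.
- by have := triangle (v_ 0) (v_ 1) (v_ 4); rewrite vset3; apply.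
- by have := gadget (v_ 0) (v_ 2) (v_ 5) (v_ 6) (v_ 3) (v_ 1); rewrite vset3; apply.
- by have := gadget (v_ 0) (v_ 2) (v_ 7) (v_ 8) (v_ 4) (v_ 1); rewrite vset3; apply.
- by have := gadget (v_ 0) (v_ 3) (v_ 9) (v_ 10) (v_ 4) (v_ 1); rewrite vset3; apply.
Qed.

Lemma NCW_example_gt2 (T : decomposition example) :
  NCW_decomposition T -> 2 < width T.
Proof.
move=> ncwT; rewrite ltnNge; apply/negP=> le_w2.
have width2 (t : node T) : #|Gamma t| <= 3.
  rewrite /width leq_subLR in le_w2.
  exact: leq_trans (leq_bigmax (F := fun t : node T => #|Gamma t|) t) le_w2.
pose F (i : 'I_6) : {set vertex example} := vset (nth [::] triples i).
have F_full i : exists t : node T, Gamma t = F i.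
  have [t sFt] := triple_forced i ncwT width2; exists t.
  apply/esym/eqP; rewrite eqEcard sFt (leq_trans (width2 t)) // card_vset.
  by case: i {sFt} => -[|[|[|[|[|[|//]]]]]].
have inj_F : injective F.
  move=> i j /vset_inj eq_ij; apply/val_inj/eqP.
  (* [tr] sorts a triple into a normal form, so injectivity reduces to computing that the six normal
     forms are distinct. *)
  pose tr (l : seq nat) := [seq k <- iota 0 11 | k \in l].
  rewrite -(nth_uniq (tr [::]) (s := map tr triples)) ?size_map ?ltn_ord //.
  by rewrite !(nth_map [::]) ?ltn_ord //; apply/eqP.
have := card_Gamma_family ncwT inj_F F_full.
(* Six sets would need six vertices, but their union lies in [{0, ..., 4}]. *)
apply/negP; rewrite card_ord -ltnNge ltnS.
have /eq_leq : #|vset (iota 0 5)| = 5 by rewrite card_vset.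
apply/leq_trans/subset_leq_card/bigcupsP=> i _; apply/subsetP=> x; rewrite !inE.
by case: i => -[|[|[|[|[|[|//]]]]]] lt_i; rewrite /= !inE => /or3P[] /eqP->.
Qed.

(** * An SC-empty decomposition of width at most 2, checked by computation *)

Lemma ord_all n (P : pred nat) : all P (iota 0 n) -> forall i : 'I_n, P i.
Proof. by move=> /allP P_iota i; apply: P_iota; rewrite mem_iota ltn_ord. Qed.

Lemma ord_all2 m n (P : nat -> pred nat) :
  all (fun k => all (P k) (iota 0 n)) (iota 0 m) -> forall (i : 'I_m) (j : 'I_n), P i j.
Proof. by move=> /ord_all P_all i; apply: ord_all. Qed.

Lemma vset_sub l l' : all [in l'] l -> vset l \subset vset l'.
Proof. by move=> /allP sub_l; apply/subsetP=> x; rewrite !inE => /sub_l. Qed.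

Definition closed_arcs (g l : seq nat) (r : seq (nat * nat)) :=
  all [pred e | [|| e.1 \in g, e.2 \in g | (e.1 \in l) ==> (e.2 \in l)]] r.

(** A computable certificate for [strong_component_path]; reversing the arcs expresses closure under
    in-arcs. *)
Lemma vset_component (g l : seq nat) (x : 'I_11) (p : seq 'I_11) :
    path [rel i j | (i, j) \in arcs] (val x) (map val p) ->
    last x p = x ->
    all [in val x :: map val p] l && all [in l] (val x :: map val p) ->
    ~~ has [in g] l ->
    closed_arcs g l arcs || closed_arcs g l [seq (e.2, e.1) | e <- arcs] ->
  @strong_component_del example (vset g) (vset l).
Proof.
move=> arc_p last_p /andP[/allP sub_lp /allP sub_pl] /hasPn notin_l closed_l.
have xl : val x \in l by apply: sub_pl; rewrite mem_head.
have in_l (y : 'I_11) : (val y \in l) = (y \in x :: p).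
  rewrite -(mem_map val_inj) /=.
  by apply/idP/idP => [/sub_lp | /sub_pl].
apply: (@strong_component_path example _ _ x p) => //.
- by rewrite inE notin_l.
- rewrite path_map in arc_p.
  apply: (sub_in_path (P := [pred y : 'I_11 | val y \in l])) arc_p => [y z yl zl yz|].
    by apply/and3P; rewrite !inE !notin_l.
  by apply/allP=> y; rewrite -in_l.
- by move=> y; rewrite inE in_l.
case/orP: closed_l => /allP/= closed_l; [left | right] => y z /and3P[yg zg yz].
  rewrite !inE in yg zg *; have := closed_l _ yz.
  by rewrite /= (negPf yg) (negPf zg) => /implyP.
rewrite !inE in yg zg *; have := closed_l _ (map_f (fun e => (e.2, e.1)) yz).
by rewrite /= (negPf yg) (negPf zg) => /implyP.
Qed.

(* Node 0 is the root.  Nodes 1 and 2 add the vertices 2 and 4 to the triangle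
   {0, 1, 3}; each of 3-5, 6-8, 9-11 is a path clearing one gadget, starting with
   an empty bag. *)
Definition parents := [:: 0; 0; 0; 1; 3; 4; 1; 6; 7; 0; 9; 10].
Definition bags :=
  [:: [:: 0; 1; 3]; [:: 2]; [:: 4]; [::]; [:: 5]; [:: 6]; [::]; [:: 7]; [:: 8];
      [::]; [:: 9]; [:: 10]].
Definition guards :=
  [:: [::]; [:: 0; 1]; [:: 0; 1]; [:: 0; 2]; [:: 2; 3]; [:: 3; 5];
      [:: 0; 2]; [:: 2; 4]; [:: 4; 7]; [:: 0; 3]; [:: 3; 4]; [:: 4; 9]].
Definition subtree_bags :=
  [:: iota 0 11; [:: 2; 5; 6; 7; 8]; [:: 4]; [:: 5; 6]; [:: 5; 6]; [:: 6];
      [:: 7; 8]; [:: 7; 8]; [:: 8]; [:: 9; 10]; [:: 9; 10]; [:: 10]].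
Definition Gammas :=
  [:: [:: 0; 1; 3]; [:: 0; 1; 2]; [:: 0; 1; 4]; [:: 0; 2; 3]; [:: 2; 3; 5];
      [:: 3; 5; 6]; [:: 0; 2; 4]; [:: 2; 4; 7]; [:: 4; 7; 8];
      [:: 0; 3; 4]; [:: 3; 4; 9]; [:: 4; 9; 10]].

Definition parent := nth 0 parents.

Lemma lt_parent k : 0 < k <= 11 -> parent k < k.
Proof. by do 12![case: k => [|k] //]. Qed.

Definition example_bag (t : 'I_12) : {set vertex example} := vset (nth [::] bags t).
(** A node has at most one incoming edge, so the head of an edge suffices to index its guard. *)
Definition example_guard (_ t : 'I_12) : {set vertex example} := vset (nth [::] guards t).

Lemma example_bag_cover : \bigcup_t example_bag t = [set: vertex example].
Proof.
apply/setP=> x; rewrite inE; apply/bigcupP.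
have /hasP[k] : has [pred k | val x \in nth [::] bags k] (iota 0 12).
  exact: (@ord_all 11 (fun y => has [pred k | y \in nth [::] bags k] (iota 0 12))).
by rewrite mem_iota => lt_k xk; exists (Ordinal lt_k); rewrite // inE.
Qed.

Definition example_tree :=
  @Decomposition example _ _ _ _ example_guard (parent_rooted_tree lt_parent) example_bag_cover.

Lemma example_subtree_bag (t : node example_tree) :
  subtree_bag t = vset (nth [::] subtree_bags t).
Proof.
move: t; apply: subtree_bagE => t; apply/setP=> x; rewrite !inE.
pose child_has k y :=
  has [pred j | [&& 0 < j, k == parent j & y \in nth [::] subtree_bags j]] (iota 0 12).
transitivity ((val x \in nth [::] bags t) || child_has t x).
  apply/eqP; exact: (@ord_all2 12 11 (fun k y =>
    (y \in nth [::] subtree_bags k) == (y \in nth [::] bags k) || child_has k y)).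
congr (_ || _); apply/hasP/bigcupP => [[j] | [j /andP[j0 jt] xj]].
  rewrite mem_iota => lt_j /and3P[j0 jt xj].
  by exists (Ordinal lt_j); [apply/andP | rewrite inE].
rewrite inE in xj; exists (val j); last exact/and3P.
by rewrite mem_iota ltn_ord.
Qed.

Lemma example_Gamma (t : node example_tree) : Gamma t \subset vset (nth [::] Gammas t).
Proof.
rewrite subUset; apply/andP; split.
  apply: vset_sub.
  exact: (@ord_all 12 (fun k => all [in nth [::] Gammas k] (nth [::] bags k))).
apply/bigcupsP=> -[s u] /= /andP[/andP[_ /eqP def_s]].
(* A guard contributes to [Gamma] at both ends of its edge, hence the check at the node and at its
   parent. *)
have /andP[] := @ord_all 12 (fun k => all [in nth [::] Gammas (parent k)] (nth [::] guards k)
  && all [in nth [::] Gammas k] (nth [::] guards k)) isT u.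
by rewrite -def_s => sub_s sub_u /orP[] /eqP<-; apply: vset_sub.
Qed.

Lemma width_example_tree : width example_tree <= 2.
Proof.
rewrite /width leq_subLR; apply/bigmax_leqP=> t _.
apply: leq_trans (subset_leq_card (example_Gamma t)) _; rewrite card_vset.
by case: t => -[|[|[|[|[|[|[|[|[|[|[|[|//]]]]]]]]]]]].
Qed.

Lemma SCempty_example_tree : SCempty_decomposition example_tree.
Proof.
split.
- move=> s t neq_st; apply/pred0P=> x /=; rewrite !inE; apply/negP=> /andP[xs xt].
  have := @ord_all2 12 12 (fun k j =>
    (k == j) || ~~ has [in nth [::] bags k] (nth [::] bags j)) isT s t.
  by rewrite val_eqE (negPf neq_st) => /hasPn/(_ _ xt); rewrite /= xs.
- by apply/set0Pn; exists (v_ 0); rewrite inE.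
- move=> s t /andP[t_gt0 _]; rewrite example_subtree_bag /= /example_guard {s}.
  case: t t_gt0 => -[|[|[|[|[|[|[|[|[|[|[|[|//]]]]]]]]]]]] lt_t // _ /=.
  + exact: (@vset_component _ _ (v_ 2) [:: v_ 5; v_ 6; v_ 5; v_ 2; v_ 7; v_ 8; v_ 7; v_ 2]).
  + exact: (@vset_component _ _ (v_ 4) [::]).
  (* [{5, 6}] is a component for two successive guards: [{0, 2}] blocks all arcs entering it,
     [{2, 3}] all arcs leaving it. The other two gadgets behave alike. *)
  + exact: (@vset_component _ _ (v_ 5) [:: v_ 6; v_ 5]).
  + exact: (@vset_component _ _ (v_ 5) [:: v_ 6; v_ 5]).
  + exact: (@vset_component _ _ (v_ 6) [::]).
  + exact: (@vset_component _ _ (v_ 7) [:: v_ 8; v_ 7]).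
  + exact: (@vset_component _ _ (v_ 7) [:: v_ 8; v_ 7]).
  + exact: (@vset_component _ _ (v_ 8) [::]).
  + exact: (@vset_component _ _ (v_ 9) [:: v_ 10; v_ 9]).
  + exact: (@vset_component _ _ (v_ 9) [:: v_ 10; v_ 9]).
  + exact: (@vset_component _ _ (v_ 10) [::]).
- by rewrite !card_ord.
Qed.

(** * Existence of NCW decompositions and the comparison *)

Lemma single_node_tree : rooted_tree (fun _ _ : unit => false) tt.
Proof. by case; exists [::]; split=> // -[|[] p] []. Qed.

(** A single bag holding all vertices; this ensures that the minimum NCW width exists. *)
Lemma NCW_exists (D : digraph) :
  0 < #|vertex D| -> exists T : decomposition D, NCW_decomposition T.
Proof.
move=> D_gt0.
have cover : \bigcup_(t : unit) [set: vertex D] = [set: vertex D].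
  by apply/setP=> x; rewrite inE; apply/bigcupP; exists tt.
exists (Decomposition (fun _ _ => set0) single_node_tree cover); split=> //.
by case; rewrite /= -card_gt0 cardsT.
Qed.

Theorem theorem4p14 :
  exists (D : digraph) (k l : nat), [/\ SCempty_is D k, NCW_is D l & k < l].
Proof.
have [k le_k2 SCk] := is_min_width_exists SCempty_example_tree.
have [|T ncwT] := @NCW_exists example; first by rewrite card_ord.
have [l _ NCWl] := is_min_width_exists ncwT.
exists example, k, l; split=> //; have [[S ncwS <-] _] := NCWl.
exact: leq_ltn_trans (leq_trans le_k2 width_example_tree) (NCW_example_gt2 ncwS).
Qed.
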